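(* Let $\Gamma$ be an oval with twice differentiable support function $p$. Then the perimeter of $\Gamma$ equals $\pi\,\overline{w}$ and equals $2\pi\,\overline{\rho}$, where $\overline{w}$ is the average width of $\Gamma$ and $\overline{\rho}$ is its average radius of curvature.
   Context: An oval is a simple closed convex plane curve $\Gamma$; the origin is chosen in its interior. The support function $p(t)$, a $2\pi$-periodic function, is the distance from the origin to the tangent line of $\Gamma$ whose perpendicular from the origin makes angle $t$ with the positive $x$-axis (i.e. with outward normal $(\cos t,\sin t)$). The point of $\Gamma$ with parameter $t$ is $x(t)=p(t)\cos t-p'(t)\sin t$, $y(t)=p(t)\sin t+p'(t)\cos t$. The radius of curvature is $\rho(t)=p(t)+p''(t)$, and convexity of $\Gamma$ means $\rho(t)\ge0$ for all $t$. The instantaneous width is $w(t)=p(t)+p(t+\pi)$, the average width is $\overline{w}=\frac1\pi\int_0^\pi w(t)\,dt$, and the average radius of curvature is $\overline{\rho}=\frac1{2\pi}\int_0^{2\pi}\rho(t)\,dt$. *)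

(* Defs.v *)
From HB Require Import structures.
From mathcomp Require Import all_boot all_order all_algebra.
From mathcomp Require Import all_classical all_reals all_analysis.

Set Implicit Arguments.
Unset Strict Implicit.
Unset Printing Implicit Defensive.

Import Order.TTheory GRing.Theory Num.Theory.
Import numFieldNormedType.Exports.

Local Open Scope classical_set_scope.
Local Open Scope ring_scope.

(* The library norm on a product is the max norm, so it is used only for the
   topology; lengths and distances are computed with [euclidean_dist]. *)
Notation plane R := (R^o * R^o)%type.

Section Plane.
Variable R : realType.
Implicit Types (q r : plane R) (gam : R -> plane R).
Implicit Types (G K L : set (plane R)) (t : R).

Definition dot q r : R := q.1 * r.1 + q.2 * r.2.

Definition euclidean_dist q r : R :=
  Num.sqrt ((q.1 - r.1) ^+ 2 + (q.2 - r.2) ^+ 2).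

Definition dist_to_set q L : R := inf [set euclidean_dist q r | r in L].

Definition dir t : plane R := (cos t, sin t).

Definition simple_closed_curve gam :=
  [/\ {within `[0%R, 1%R], continuous gam},
      gam 0 = gam 1 &
      {in `[0%R, 1%R[ &, injective gam}].

Definition trace gam : set (plane R) := gam @` `[0%R, 1%R].

(* A simple closed curve is convex when the region it encloses is convex: [K]
   is that region, and the curve is its topological boundary. *)
Definition oval gam :=
  simple_closed_curve gam /\
  exists K : set (plane R),
    [/\ compact K, convex_set (K : set (convex_lmodType (plane R))), K° (0, 0) &
        trace gam = K `\` K°].

(* The tangent line with outward normal [dir t]. It is described as a support
   line so that it also makes sense at a corner of [G], which a twice
   differentiable support function allows. *)
Definition tangent_line G t : set (plane R) :=
  [set q | exists2 r, G r &
     dot q (dir t) = dot r (dir t) /\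
     forall s, G s -> dot s (dir t) <= dot r (dir t)].

Definition support_function G t : R := dist_to_set (0, 0) (tangent_line G t).

Definition polygon_length gam (s : seq R) : R :=
  \sum_(0 <= i < (size s).-1) euclidean_dist (gam s`_i) (gam s`_i.+1).

Definition perimeter gam : \bar R :=
  ereal_sup [set (polygon_length gam (0%R :: s))%:E | s in itv_partition 0 1].

End Plane.

Section Averages.
Variable R : realType.
Implicit Types (p : R -> R) (t : R).

Definition twice_differentiable p :=
  forall t, derivable p t 1 /\ derivable (derive1 p) t 1.

Definition curvature_radius p t : R := p t + derive1 (derive1 p) t.

Definition width p t : R := p t + p (t + pi).

Definition average_width p : R :=
  pi^-1 * \int[lebesgue_measure]_(t in `[0, pi]) width p t.

(* As the second derivative need not be continuous, this has to be
   a Lebesgue integral. *)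
Definition average_curvature_radius p : R :=
  (2 * pi)^-1 *
  \int[lebesgue_measure]_(t in `[0, 2 * pi]) curvature_radius p t.

End Averages.

(* Main.v *)
Require Import Defs.
From mathcomp Require Import all_boot all_order all_algebra.
From mathcomp Require Import all_classical all_reals all_analysis.
From mathcomp Require Import measurable_realfun ring lra.

Set Implicit Arguments.
Unset Strict Implicit.
Unset Printing Implicit Defensive.

Import Order.TTheory GRing.Theory Num.Theory.
Import numFieldNormedType.Exports.

Local Open Scope classical_set_scope.
Local Open Scope ring_scope.

(** Write [p] for the support function and [w] for the width. For a direction
    [t], let [phi u] be the projection of the point [gam u] on [dir t].

    Perimeter. A segment [e] satisfies Cauchy's formula
    [2 |e| = \int_0^pi |<e, dir t>| dt] ([integral_abs_dir]), so twice the length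
    of an inscribed polygon is the integral over [[0, pi]] of its total projected
    length ([integral_projected_length]). That projected length is the sum of the
    increments of [phi] in absolute value. It is at most [2 w t]
    ([projected_length_le]): [phi] ranges over [[- p (t + pi), p t]], a line
    through an interior point of the region meets the frontier in at most two
    points ([frontier_line_le2]), so each intermediate value is taken at most
    twice, and integrating over the values the number of increments that cross
    them gives the bound ([variation_le_of_le2_preimages]). It is at least
    [2 (w t - 4 e)] as soon as every point of the curve is within [e] of a vertex,
    because the polygon is closed and comes close to both extreme points
    ([projected_length_ge]). Hence the perimeter is [\int_0^pi w], which is also
    [\int_0^(2 pi) p]. No cyclic ordering of the curve is needed.

    Curvature. Since [p s >= <r, dir s>] for a point [r] of the curve, with
    equality at [t] when [r] is a support point in the direction [t], the second
    derivative test gives [p + p'' >= 0]. So [p''] is bounded below on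
    [[0, 2 pi]], and [\int_0^(2 pi) p'' = p' (2 pi) - p' 0 = 0] by periodicity.
    As [p''] need not be continuous, this uses the fundamental theorem of calculus
    for an everywhere differentiable function whose derivative is nonnegative
    ([ge0_derivable_FTC2]). Both of its inequalities follow from
    [increment_le_integral]: if [F' <= v] everywhere and [v >= 0] is measurable,
    then [F b - F a <= \int_a^b v]. It is proved by covering the level sets of [v]
    with slightly larger open sets. *)

(** * Segment induction and local increments *)

(** A property of subsegments that is additive and holds for all small enough
    subsegments around each point holds for the whole segment. *)
Lemma segment_induction (R : realType) (P : R -> R -> Prop) (a b : R) :
  a <= b ->
  (forall x y z, x <= y -> y <= z -> P x y -> P y z -> P x z) ->
  (forall x, a <= x <= b -> exists2 d, 0 < d &
     forall y z, a <= y -> y <= x -> x <= z -> z <= b -> x - d < y -> z < x + d ->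
     P y z) ->
  P a b.
Proof.
move=> ab trP locP.
pose S := [set x | a <= x <= b /\ P a x].
have aS : S a.
  split; first by rewrite lexx.
  have /locP[d d0 H] : a <= a <= b by rewrite lexx.
  by apply: H => //; rewrite ?ltrDl // ltrBlDr ltrDl.
have supS : has_sup S.
  by split; [exists a | exists b => x [/andP[_ ->]]].
have ac : a <= sup S by apply: ub_le_sup => //; case: supS.
have cb : sup S <= b by apply: ge_sup; [exists a | move=> x [/andP[]]].
have /locP[d d0 H] : a <= sup S <= b by rewrite ac.
(* The supremum of the right ends that can be reached is reached, and is b. *)
have [x [/andP[ax xb] Pax] xc] := sup_adherent d0 supS.
have xS : x <= sup S by apply: ub_le_sup; [case: supS | split=> //; rewrite ax].
have Pac z : sup S <= z -> z <= b -> z < sup S + d -> P a z.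
  by move=> cz zb zd; apply: (trP _ x) => //; [exact: le_trans cz | exact: H].
have [->|cnb] := eqVneq b (sup S); first by apply: Pac => //; rewrite ltrDl.
have {cnb} cltb : sup S < b by rewrite lt_neqAle eq_sym cnb.
pose z := Num.min b (sup S + d / 2).
have cz : sup S < z by rewrite lt_min cltb ltrDl divr_gt0.
have zb : z <= b by rewrite ge_min lexx.
have zd : z < sup S + d by rewrite gt_min; apply/orP; right; lra.
suff : z <= sup S by rewrite leNgt cz.
apply: ub_le_sup; first by case: supS.
split; last by apply: Pac => //; exact: ltW.
by rewrite zb (le_trans ac) // ltW.
Qed.

Lemma derivable_approx (R : realType) (F : R -> R) (x e : R) :
  0 < e -> derivable F x 1 ->
  exists2 d, 0 < d &
    forall y, `|y - x| < d -> `|F y - F x - derive1 F x * (y - x)| <= e * `|y - x|.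
Proof.
move=> e0; rewrite /derivable => /cvgrPdist_lt /(_ _ e0).
rewrite -[lim _]/('D_1 F x) -derive1E => /nbhs_ballP[d /= d0 H]; exists d => // y yd.
have [->|yx] := eqVneq y x; first by rewrite !subrr mulr0 subr0 normr0 mulr0.
have yx0 : y - x != 0 by rewrite subr_eq0.
have /= := H (y - x); rewrite /ball /= sub0r normrN => /(_ yd yx0).
rewrite /GRing.scale /= mulr1 subrK => /ltW; rewrite distrC => H'.
have -> : F y - F x - derive1 F x * (y - x) =
          ((y - x)^-1 * (F y - F x) - derive1 F x) * (y - x).
  by field.
by rewrite normrM ler_wpM2r.
Qed.

Lemma derivable_increment_le (R : realType) (F : R -> R) (x e : R) :
  0 < e -> derivable F x 1 ->
  exists2 d, 0 < d & forall y z, y <= x -> x <= z -> x - d < y -> z < x + d ->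
    F z - F y <= (derive1 F x + e) * (z - y).
Proof.
move=> e0 /(derivable_approx e0)[d d0 H]; exists d => // y z yx xz dy zd.
have /H : `|y - x| < d by rewrite ler0_norm ?subr_le0 //; lra.
have /H : `|z - x| < d by rewrite ger0_norm ?subr_ge0 //; lra.
rewrite (ler0_norm (x := y - x)) ?subr_le0 // (ger0_norm (x := z - x)) ?subr_ge0 //.
rewrite !ler_norml => /andP[_ h1] /andP[h2 _].
lra.
Qed.

(** * Integrals of nonnegative derivatives *)

(** If [F' <= v] on [[a, b]] with [v] nonnegative and measurable, then
    [F b - F a <= \int_a^b v], without any integrability or continuity of [F']. *)
Section IncrementLeIntegral.
Variables (R : realType) (F v : R -> R) (a b : R).
Hypotheses (ab : a <= b) (mv : measurable_fun `[a, b] v).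
Hypothesis v0 : forall x, a <= x <= b -> 0 <= v x.
Hypothesis dF : forall x, a <= x <= b -> derivable F x 1.
Hypothesis Fv : forall x, a <= x <= b -> derive1 F x <= v x.
Local Notation mu := (@lebesgue_measure R).

(** The level sets of [v] at scale [e], which partition [[a, b]]. *)
Let level (e : R) k : set R :=
  `[a, b] `&` v @^-1` [set y | k%:R * e <= y < k.+1%:R * e].

Let measurable_level e k : measurable (level e k).
Proof.
apply: mv => //.
have -> : [set y : R | k%:R * e <= y < k.+1%:R * e] =
          `[k%:R * e, k.+1%:R * e[%classic.
  by apply/seteqP; split => y /=; rewrite in_itv.
exact: measurable_itv.
Qed.

Let trivIset_level e : 0 < e -> trivIset setT (level e).
Proof.
move=> e0; apply/trivIsetP => i j _ _ ij; apply/seteqP; split => //= x.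
move=> [[_ /= /andP[i1 i2]] [_ /= /andP[j1 j2]]].
have : i%:R * e < j.+1%:R * e by exact: le_lt_trans i1 j2.
have : j%:R * e < i.+1%:R * e by exact: le_lt_trans j1 i2.
rewrite !ltr_pM2r // !ltr_nat !ltnS => h1 h2.
by move/eqP: ij; apply; apply/eqP; rewrite eqn_leq h1 h2.
Qed.

Let bigcup_level e : 0 < e -> \bigcup_k level e k = `[a, b]%classic.
Proof.
move=> e0; apply/seteqP; split => [x [k _ []] //|x xab].
exists (Num.truncn (v x / e)) => //; split => //=.
have v0x : 0 <= v x / e.
  by apply: divr_ge0; [apply: v0; move: xab; rewrite /= in_itv | exact: ltW].
by rewrite -ler_pdivlMr // -ltr_pdivrMr // truncn_itv.
Qed.

(** Outer regularity gives an open [U] around the [k]-th level set whose excess of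
    measure, weighted by the upper value [(k + 1) e] of [v], is at most
    [e / 2 ^ (k + 1)]: summable in [k], with sum [e]. *)
Let level_cover e k : 0 < e -> exists U : set R, [/\ open U, level e k `<=` U &
  ((k.+1%:R * e)%:E * mu U <=
     \int[mu]_(x in level e k) (v x + e)%:E + (e / (2 ^ k.+1)%:R)%:E)%E].
Proof.
move=> e0.
have ke0 : 0 < k.+1%:R * e by rewrite mulr_gt0.
have d0 : 0 < e / (2 ^ k.+1)%:R / (k.+1%:R * e).
  by rewrite !divr_gt0 // ltr0n expn_gt0.
have finl : (mu (level e k) < +oo)%E.
  apply: (@le_lt_trans _ _ (mu `[a, b]%classic)).
    apply: le_measure; rewrite ?inE //; [exact: measurable_level|].
    exact: subIsetl.
  by rewrite lebesgue_measure_itv /=; case: ifP => _; rewrite ltry.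
have [U [oU lU Ul]] := lebesgue_regularity_outer (measurable_level e k) finl d0.
exists U; split => //.
have mU : measurable U := open_measurable oU.
rewrite (measureDI mu mU (measurable_level e k)) setIidr // [leRHS]addeC.
rewrite ge0_muleDr //; apply: leeD.
  apply: (@le_trans _ _ ((k.+1%:R * e)%:E *
      (e / (2 ^ k.+1)%:R / (k.+1%:R * e))%:E)%E).
    by apply: lee_wpmul2l; [rewrite lee_fin ltW | exact: ltW].
  by rewrite -EFinM lee_fin mulrC divfK // gt_eqF.
rewrite -integral_cst //; last exact: measurable_level.
apply: ge0_le_integral => //=.
- exact: measurable_level.
- by move=> x _; rewrite lee_fin ltW.
- apply/measurable_EFinP; apply: measurable_funD => //.
  by apply: measurable_funS mv => //; exact: subIsetl.
- move=> x [_ /= /andP[h _]]; rewrite lee_fin -addn1 natrD mulrDl mul1r.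
  by rewrite lerD2r.
Qed.

Let increment_le_integral_eps e : 0 < e ->
  ((F b - F a - e * (b - a))%:E <=
    \int[mu]_(x in `[a, b]) (v x)%:E + (e * (b - a) + e)%:E)%E.
Proof.
move=> e0.
have /choice [U HU] := fun k => @level_cover e k e0.
have mU k : measurable (U k) by case: (HU k) => oU _ _; exact: open_measurable.
(* nu is the measure with density the sum of (k + 1) e over the k such that U k
   contains the point: near every x, this density is at least v x. *)
pose nu (A : set R) := (\sum_(k <oo) (k.+1%:R * e)%:E * mu (U k `&` A))%E.
have t0 A k : (0 <= (k.+1%:R * e)%:E * mu (U k `&` A))%E.
  by apply: mule_ge0 => //; rewrite lee_fin mulr_ge0 // ltW.
have nuab : (nu `]a, b]%classic <=
    \int[mu]_(x in `[a, b]) (v x + e)%:E + e%:E)%E.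
  rewrite -(bigcup_level e0) ge0_integral_bigcup /=; first last.
  - exact: trivIset_level.
  - rewrite bigcup_level // => x; rewrite /= in_itv => /v0 vx.
    by rewrite lee_fin addr_ge0 // ltW.
  - rewrite bigcup_level //; apply/measurable_EFinP.
    exact: measurable_funD.
  - exact: measurable_level.
  apply: le_trans (epsilon_trick _ _ (ltW e0)); last first.
    move=> k; apply: integral_ge0 => x [+ _]; rewrite /= in_itv => /v0 vx.
    by rewrite lee_fin addr_ge0 // ltW.
  apply: lee_nneseries => // k _; case: (HU k) => _ _; apply: le_trans.
  apply: lee_wpmul2l; first by rewrite lee_fin mulr_ge0 // ltW.
  apply: le_measure; last by move=> u [].
    by rewrite inE; apply: measurableI => //; exact: mU.
  by rewrite inE; exact: mU.
have P : ((F b - F a - e * (b - a))%:E <= nu `]a, b]%classic)%E.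
  apply: (@segment_induction _
      (fun y z => ((F z - F y - e * (z - y))%:E <= nu `]y, z]%classic)%E)) => //.
    move=> x y z xy yz h1 h2.
    have -> : F z - F x - e * (z - x) =
      (F y - F x - e * (y - x)) + (F z - F y - e * (z - y)) by ring.
    rewrite EFinD; apply: le_trans (leeD h1 h2) _.
    rewrite -nneseriesD //; apply: lee_nneseries => [k _ _|k _]; first exact: adde_ge0.
    rewrite -ge0_muleDr // -measureU;
      [|by apply: measurableI => //; exact: mU|by apply: measurableI => //; exact: mU|].
      rewrite -setIUr; have -> : `]x, y]%classic `|` `]y, z]%classic = `]x, z]%classic.
        by rewrite -itv_bndbnd_setU.
      by [].
    apply/seteqP; split => //= u [[_ +] [_ +]]; rewrite /= !in_itv /=.
    by move=> /andP[_ h] /andP[h' _]; have := lt_le_trans h' h; rewrite ltxx.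
  (* Local bound around a point x of the k-th level set. *)
  move=> x xab; pose k := Num.truncn (v x / e).
  have [_ [h1 h2]] : level e k x /\ k%:R * e <= v x /\ v x < k.+1%:R * e.
    have : `[a, b]%classic x by rewrite /= in_itv.
    rewrite -(bigcup_level e0) => -[k' _ [h /= h']].
    suff -> : k = k' by split => //; apply/andP.
    have vx0 := v0 xab.
    apply/eqP; rewrite /k truncn_eq ?divr_ge0 ?(ltW e0) //.
    by rewrite ler_pdivlMr // ltr_pdivrMr.
  have Ukx : U k x.
    case: (HU k) => _ + _; apply; split => /=; first by rewrite in_itv.
    by rewrite h1.
  case: (HU k) => /(_ _ Ukx); rewrite /interior => /nbhs_ballP[d1 /= d10 Hd1] _ _.
  have [d2 d20 Hd2] := derivable_increment_le e0 (dF xab).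
  exists (Num.min d1 d2); first by rewrite lt_min d10.
  have dle1 : Num.min d1 d2 <= d1 by rewrite ge_min lexx.
  have dle2 : Num.min d1 d2 <= d2 by rewrite ge_min lexx orbT.
  move=> y z ay yx xz zb dy dz.
  have yzU : `]y, z]%classic `<=` U k.
    move=> u; rewrite /= in_itv /= => /andP[yu uz]; apply: Hd1.
    by rewrite /ball /= ltr_norml; apply/andP; split; lra.
  apply: (@le_trans _ _ ((k.+1%:R * e) * (z - y))%:E).
    rewrite lee_fin.
    have := Hd2 y z yx xz (le_lt_trans (lerB (lexx x) dle2) dy)
      (lt_le_trans dz (lerD (lexx x) dle2)).
    move=> H.
    have : derive1 F x * (z - y) <= (k.+1%:R * e) * (z - y).
      rewrite ler_wpM2r ?subr_ge0 ?(le_trans yx) //.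
      by rewrite (le_trans (Fv xab)) // ltW.
    by lra.
  apply: (@le_trans _ _ ((k.+1%:R * e)%:E * mu (U k `&` `]y, z]%classic))%E).
    rewrite setIidr // lebesgue_measure_itv /= lte_fin.
    case: ifPn; first by rewrite EFinM.
    rewrite -leNgt => zy; rewrite mule0 lee_fin mulr_ge0_le0 ?subr_le0 //.
    by rewrite mulr_ge0 // ltW.
  apply: le_trans (nneseries_lim_ge k.+1 _) => //.
  rewrite big_nat_recr //= leeDr //; exact: sume_ge0.
apply: (le_trans P); apply: (le_trans nuab).
under eq_integral do rewrite EFinD.
rewrite ge0_integralD //=.
- rewrite integral_cst //= lebesgue_measure_itv /= lte_fin EFinD addeA.
  apply: leeD => //; apply: leeD => //.
  case: ifP => _; first by rewrite -EFinB -EFinM.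
  by rewrite mule0 lee_fin mulr_ge0 ?(ltW e0) // subr_ge0.
- exact/measurable_EFinP.
- by move=> x _; rewrite lee_fin ltW.
Qed.

Lemma increment_le_integral :
  ((F b - F a)%:E <= \int[mu]_(x in `[a, b]) (v x)%:E)%E.
Proof.
have : (0 <= \int[mu]_(x in `[a, b]) (v x)%:E)%E.
  by apply: integral_ge0 => x; rewrite /= in_itv /= => /v0; rewrite lee_fin.
move: increment_le_integral_eps.
case: (\int[mu]_(x in `[a, b]) (v x)%:E)%E => [r| |] // H _; last exact: leey.
rewrite lee_fin; apply/ler_addgt0Pr => e e0.
pose c := 2 * (b - a) + 1.
have c0 : 0 < c by rewrite /c ltr_wpDl // mulr_ge0 // subr_ge0.
have := H (e / c) (divr_gt0 e0 c0).
rewrite -EFinD lee_fin.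
have -> : e / c * (b - a) + e / c = e - e / c * (b - a).
  by rewrite /c; field; rewrite gt_eqF.
by lra.
Qed.

End IncrementLeIntegral.

(** The fundamental theorem of calculus for an everywhere differentiable function
    whose derivative is nonnegative on [[a, b]], and possibly discontinuous. *)
Section NonnegativeDerivative.
Variables (R : realType) (f : R -> R).
Hypothesis df : forall x, derivable f x 1.
Local Notation mu := (@lebesgue_measure R).

Lemma derivable_measurable : measurable_fun setT f.
Proof.
apply: continuous_measurable_fun => x.
by apply/differentiable_continuous/derivable1_diffP.
Qed.

(** A derivative is the pointwise limit of difference quotients. *)
Lemma derive1_measurable : measurable_fun setT (derive1 f).
Proof.
apply: (@measurable_fun_cvg _ _ R [set: R]
  (fun n x => n.+1%:R * (f (x + n.+1%:R^-1) - f x))) => [n|x _].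
  apply: measurable_funM => //; apply: measurable_funB; last exact: derivable_measurable.
  apply: measurableT_comp; first exact: derivable_measurable.
  exact: measurable_funD.
apply/cvgrPdist_le => e e0.
have [d d0 H] := derivable_approx e0 (@df x).
near=> n.
have n0 : 0 < n.+1%:R^-1 :> R by rewrite invr_gt0.
have := H (x + n.+1%:R^-1).
rewrite addrAC subrr add0r (gtr0_norm n0).
have -> : n.+1%:R^-1 < d by near: n; exact: near_infty_natSinv_lt (PosNum d0).
move=> /(_ isT) Hn; rewrite distrC.
have -> : n.+1%:R * (f (x + n.+1%:R^-1) - f x) - derive1 f x =
  (f (x + n.+1%:R^-1) - f x - derive1 f x * n.+1%:R^-1) / n.+1%:R^-1 :> R.
  have : n.+1%:R != 0 :> R by rewrite pnatr_eq0.
  by move: (n.+1%:R) => k k0; field.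
by rewrite normrM normfV (gtr0_norm n0) ler_pdivrMr.
Unshelve. all: by end_near. Qed.

Variables (a b : R).
Hypotheses (ab : a <= b) (f'0 : forall x, a <= x <= b -> 0 <= derive1 f x).

(** The bound for the derivative truncated at [N] comes from
    [increment_le_integral] applied to [y |-> N y - f y], whose derivative
    [N - f'] is at most [max (N - f') 0]. *)
Let trunc_integral_le (N : nat) :
  (\int[mu]_(x in `[a, b]) (Num.min (derive1 f x) N%:R)%:E <= (f b - f a)%:E)%E.
Proof.
have mf : measurable_fun `[a, b] (derive1 f).
  by apply: measurable_funTS; exact: derive1_measurable.
pose v x := Num.max (N%:R - derive1 f x) 0.
have mv : measurable_fun `[a, b] v.
  by apply: measurable_maxr => //; exact: measurable_funB.
have v0 x : 0 <= v x by rewrite le_max lexx orbT.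
have m0 x : a <= x <= b -> 0 <= Num.min (derive1 f x) N%:R.
  by move=> /f'0 f'x; rewrite le_min f'x ler0n.
have dF (x : R) : is_derive x 1 (fun y => N%:R * y - f y) (N%:R - derive1 f x).
  have -> : (fun y => N%:R * y - f y) = (N%:R \*: (@id R) - f).
    by apply/funext.
  apply: is_deriveB; last by rewrite derive1E; exact: derivableP.
  have := @is_deriveZ R R^o R^o id N%:R x 1 1 (is_derive_id _ _).
  by rewrite /GRing.scale /= mulr1.
have H : ((N%:R * b - f b - (N%:R * a - f a))%:E <=
          \int[mu]_(x in `[a, b]) (v x)%:E)%E.
  apply: (@increment_le_integral _ (fun y => N%:R * y - f y)) => //.
  - by move=> x _; rewrite derive1E (@derive_val _ _ _ _ _ _ _ (dF x)) le_max lexx.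
have S : (\int[mu]_(x in `[a, b]) (Num.min (derive1 f x) N%:R)%:E +
          \int[mu]_(x in `[a, b]) (v x)%:E = (N%:R * (b - a))%:E)%E.
  rewrite -ge0_integralD //=; first last.
  - exact/measurable_EFinP.
  - by move=> x _; rewrite lee_fin.
  - by apply/measurable_EFinP; exact: measurable_minr.
  transitivity (\int[mu]_(x in `[a, b]) (cst N%:R%:E x))%E.
    apply: eq_integral => x _; rewrite -EFinD /v; congr EFin.
    by case: (leP (derive1 f x) N%:R); case: (leP (N%:R - derive1 f x) 0); lra.
  rewrite integral_cst //= lebesgue_measure_itv /= lte_fin.
  case: ltP => [_|ba]; first by rewrite -EFinB -EFinM.
  by rewrite mule0; have -> : a = b; [apply/le_anti/andP | rewrite subrr mulr0].
move: S H.
have : (0 <= \int[mu]_(x in `[a, b]) (v x)%:E)%E.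
  by apply: integral_ge0 => x _; rewrite lee_fin.
have : (0 <= \int[mu]_(x in `[a, b]) (Num.min (derive1 f x) N%:R)%:E)%E.
  by apply: integral_ge0 => x; rewrite /= in_itv /= lee_fin; exact: m0.
case: (\int[mu]_(x in `[a, b]) (v x)%:E)%E => [r| |] //;
case: (\int[mu]_(x in `[a, b]) (Num.min (derive1 f x) N%:R)%:E)%E => [s| |] //.
by move=> _ _; rewrite -EFinD !lee_fin => -[]; lra.
Qed.

Lemma ge0_derivable_FTC2 :
  (\int[mu]_(x in `[a, b]) (derive1 f x)%:E = (f b - f a)%:E)%E.
Proof.
have mf : measurable_fun `[a, b] (derive1 f).
  by apply: measurable_funTS; exact: derive1_measurable.
apply/eqP; rewrite eq_le; apply/andP; split; last first.
  exact: increment_le_integral.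
pose g (N : nat) x := (Num.min (derive1 f x) N%:R)%:E.
have gl x : g ^~ x @ \oo --> (derive1 f x)%:E.
  apply: cvg_near_cst; near=> N; rewrite /g; congr EFin.
  apply/min_idPl; near: N; exact: nbhs_infty_ger.
have -> : (\int[mu]_(x in `[a, b]) (derive1 f x)%:E =
           \int[mu]_(x in `[a, b]) limn (g ^~ x))%E.
  by apply: eq_integral => x _; apply/esym/cvg_lim; [exact: ereal_hausdorff|].
have mg N : measurable_fun `[a, b] (g N).
  by apply/measurable_EFinP; exact: measurable_minr.
have g0 N x : `[a, b]%classic x -> (0 <= g N x)%E.
  by rewrite /= in_itv /= => /f'0 f'x; rewrite lee_fin le_min f'x ler0n.
have ndg x : `[a, b]%classic x -> nondecreasing_seq (g ^~ x).
  move=> _ m n mn; rewrite lee_fin le_min ge_min lexx /= ge_min ler_nat mn.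
  by rewrite orbT.
rewrite (monotone_convergence mu _ mg g0 ndg) //; apply: lime_le.
  apply: ereal_nondecreasing_is_cvgn => m n mn.
  apply: ge0_le_integral => //; [exact: g0 | exact: mg | exact: mg |].
  by move=> x xab; exact: ndg.
by near=> N; exact: trunc_integral_le.
Unshelve. all: by end_near. Qed.

End NonnegativeDerivative.

(** * Variation along a partition *)

Lemma incr_le (R : realType) (x : nat -> R) (n : nat) :
  (forall i, (i < n)%N -> x i < x i.+1) ->
  forall i j, (i <= j)%N -> (j <= n)%N -> x i <= x j.
Proof.
move=> x_incr i j; elim: j => [|j IH]; first by rewrite leqn0 => /eqP ->.
rewrite leq_eqVlt => /predU1P[->//|]; rewrite ltnS => ij jn.
exact: le_trans (IH ij (ltnW jn)) (ltW (x_incr _ jn)).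
Qed.

(** Along any increasing sequence of points of [[a, b]], the increments of a
    continuous function with values between [m] and [M] that takes each value
    strictly between [m] and [M] at most twice on the open interval add up to at
    most [2 (M - m)] in absolute value. *)
Section VariationOfFewToOne.
Variables (R : realType) (a b : R) (phi : R -> R) (m M : R).
Hypothesis cphi : {within `[a, b], continuous phi}.
Hypothesis mM : m <= M.
Hypothesis phi_itv : forall t, a <= t <= b -> m <= phi t <= M.
Hypothesis phi_le2 : forall c s t u, m < c < M -> a < s < b -> a < t < b ->
  a < u < b -> phi s = c -> phi t = c -> phi u = c -> [\/ s = t, t = u | u = s].
Variables (x : nat -> R) (n : nat).
Hypothesis x_itv : forall i, (i <= n)%N -> a <= x i <= b.
Hypothesis x_incr : forall i, (i < n)%N -> x i < x i.+1.
Local Notation mu := (@lebesgue_measure R).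

(** The values strictly between those of [phi] at two consecutive points. *)
Let J i : set R :=
  `]Num.min (phi (x i)) (phi (x i.+1)), Num.max (phi (x i)) (phi (x i.+1))[.

(** The preimage is found strictly between the two points, so distinct [i] give
    distinct preimages. *)
Let J_preimage i c : (i < n)%N -> J i c ->
  exists2 s, x i < s < x i.+1 & phi s = c.
Proof.
move=> ltin; rewrite /J /= in_itv /= => /andP[h1 h2].
have [||s] := @IVT _ phi (x i) (x i.+1) c (ltW (x_incr ltin)).
- apply: continuous_subspaceW cphi => s; rewrite /= !in_itv /= => /andP[s1 s2].
  case/andP: (x_itv (ltnW ltin)) => h _; case/andP: (x_itv ltin) => _ h'.
  by rewrite (le_trans h) // (le_trans _ h').
  by rewrite (ltW h1) (ltW h2).
rewrite in_itv /= => /andP[s1 s2] sc; exists s => //.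
have sx y : phi y = Num.min (phi (x i)) (phi (x i.+1)) \/
    phi y = Num.max (phi (x i)) (phi (x i.+1)) -> s != y.
  move=> hy; apply/eqP => sy; move: h1 h2; rewrite -sc sy.
  by case: hy => <-; rewrite ltxx.
rewrite !lt_neqAle s1 s2 !andbT eq_sym !sx //.
  by case: (leP (phi (x i)) (phi (x i.+1))) => _; [right|left].
by case: (leP (phi (x i)) (phi (x i.+1))) => _; [left|right].
Qed.

Let sum_indic_le2 c : m < c < M -> \sum_(i < n) \1_(J i) c <= 2 :> R.
Proof.
move=> cmM.
have -> : \sum_(i < n) \1_(J i) c = #|[pred i : 'I_n | c \in J i]|%:R :> R.
  rewrite -sum1_card natr_sum [RHS]big_mkcond /=; apply: eq_bigr => i _.
  by rewrite inE indicE; case: (c \in J i).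
rewrite ler_nat leqNgt; apply/negP => /card_gt2P[i [j [k]]].
rewrite !inE => -[[Ji Jj Jk] [ij jk ki]].
have [s si sc] := J_preimage (ltn_ord i) Ji.
have [t tj tc] := J_preimage (ltn_ord j) Jj.
have [u uk uc] := J_preimage (ltn_ord k) Jk.
have inab (l : 'I_n) y : x l < y < x l.+1 -> a < y < b.
  move=> /andP[h1 h2].
  case/andP: (x_itv (ltnW (ltn_ord l))) => h _; case/andP: (x_itv (ltn_ord l)) => _ h'.
  by rewrite (le_lt_trans h) // (lt_le_trans h2).
have sep_lt (l l' : 'I_n) y y' : (l < l')%N ->
    x l < y < x l.+1 -> x l' < y' < x l'.+1 -> y != y'.
  move=> ll' /andP[_ h] /andP[h' _]; rewrite lt_eqF //.
  by rewrite (lt_le_trans h) // (le_trans _ (ltW h')) // (incr_le x_incr) // ltnW.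
have sep (l l' : 'I_n) y y' : l != l' ->
    x l < y < x l.+1 -> x l' < y' < x l'.+1 -> y != y'.
  move=> ll' hy hy'; have [h|h|h] := ltngtP l l'.
  - exact: sep_lt h hy hy'.
  - by rewrite eq_sym; exact: sep_lt h hy' hy.
  - by move: ll'; rewrite (val_inj h) eqxx.
case: (phi_le2 cmM (inab _ _ si) (inab _ _ tj) (inab _ _ uk) sc tc uc).
- exact/eqP/(sep _ _ _ _ ij).
- exact/eqP/(sep _ _ _ _ jk).
- exact/eqP/(sep _ _ _ _ ki).
Qed.

Lemma variation_le_of_le2_preimages :
  \sum_(0 <= i < n) `|phi (x i.+1) - phi (x i)| <= 2 * (M - m).
Proof.
have mJ i : measurable (J i) by exact: measurable_itv.
have JmM i : (i < n)%N -> J i `<=` `]m, M[.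
  move=> ltin c; rewrite /J /= !in_itv /= gt_min lt_max.
  have /andP[h1 h2] := phi_itv (x_itv (ltnW ltin)).
  have /andP[h3 h4] := phi_itv (x_itv ltin).
  move=> /andP[/orP h5 /orP h6].
  apply/andP; split.
    by case: h5; apply: le_lt_trans.
  by case: h6 => h6; apply: lt_le_trans h6 _.
rewrite big_mkord -lee_fin.
have -> : (\sum_(i < n) `|phi (x i.+1) - phi (x i)|)%:E =
          (\int[mu]_(c in `]m, M[) \sum_(i < n) (\1_(J i) c)%:E)%E.
  rewrite ge0_integral_sum //=; last first.
    by move=> i; apply/measurable_EFinP; by apply: measurable_indic; exact: mJ.
  rewrite -sumEFin; apply: eq_bigr => i _.
  rewrite integral_indic //=; last exact: mJ.
  rewrite setIidl; last exact: JmM.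
  rewrite lebesgue_measure_itv /= lte_fin.
  case: (ltgtP (phi (x i)) (phi (x i.+1))) => h.
  - by rewrite h -EFinB ger0_norm // subr_ge0 ltW.
  - by rewrite h -EFinB ltr0_norm ?subr_lt0 // opprB.
  - by rewrite h ltxx subrr normr0.
have -> : (2 * (M - m))%:E = (\int[mu]_(c in `]m, M[) cst 2%:E c)%E.
  rewrite integral_cst //= lebesgue_measure_itv /= lte_fin.
  case: (ltP m M) => [_|Mm]; first by rewrite -EFinB -EFinM.
  by have -> : m = M; [apply/le_anti/andP | rewrite subrr mulr0 mule0].
apply: ge0_le_integral => //=.
- by move=> c _; apply: sume_ge0 => i _; rewrite lee_fin.
- apply: emeasurable_sum => i; apply/measurable_EFinP.
  by apply: measurable_indic; exact: mJ.
- move=> c; rewrite in_itv /= sumEFin lee_fin; exact: sum_indic_le2.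
Qed.

End VariationOfFewToOne.

(** A continuous curve has partitions at which it comes within [e] of each of its
    points. *)
Lemma exists_fine_partition (R : realType) (V : normedModType R) (gam : R -> V)
    (a b e : R) :
  a <= b -> {within `[a, b], continuous gam} -> 0 < e ->
  exists2 s, itv_partition a b s &
    forall u, a <= u <= b -> exists2 x, x \in a :: s & `|gam u - gam x| <= e.
Proof.
move=> ab cgam e0.
pose P y z := exists2 s, itv_partition y z s &
    forall u, y <= u <= z -> exists2 x, x \in y :: s & `|gam u - gam x| <= e.
apply: (segment_induction (P := P)) => //.
- move=> x y z xy yz [s [ps /eqP ls] Hs] [s' [ps' /eqP ls'] Hs'].
  exists (s ++ s').
    by split; rewrite ?cat_path ?last_cat ls ?ps ?ls'.
  move=> u /andP[xu uz]; have [uy|/ltW yu] := leP u y.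
    have [|w ws wu] := Hs u; first by rewrite xu.
    by exists w => //; rewrite -cat_cons mem_cat ws.
  have [|w] := Hs' u; first by rewrite yu.
  rewrite inE => /orP[/eqP -> wu|ws' wu].
    by exists y => //; rewrite -cat_cons mem_cat -ls mem_last.
  by exists w => //; rewrite -cat_cons mem_cat ws' orbT.
- move=> x xab; have xi : `[a, b]%classic x by rewrite /= in_itv.
  have /subspace_continuousP /(_ x xi) := cgam.
  move=> /cvgrPdist_le /(_ (e / 2) (divr_gt0 e0 (ltr0Sn _ 1))).
  rewrite near_withinE => /nbhs_ballP[d /= d0 H].
  exists d => // y z ay yx xz zb dy dz.
  have near_x u : y <= u <= z -> `|gam x - gam u| <= e / 2.
    move=> /andP[yu uz]; apply: H.
      by rewrite /ball /= ltr_norml; apply/andP; split; lra.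
    by rewrite /= in_itv /= (le_trans ay) // (le_trans uz).
  have Hy u : y <= u <= z -> `|gam u - gam y| <= e.
    move=> yuz; rewrite -(subrKA (gam x)) (splitr e).
    apply: le_trans (ler_normD _ _) _; apply: lerD; last first.
      by apply: near_x; rewrite lexx (le_trans yx).
    by rewrite distrC; exact: near_x.
  have [yz|yz] := eqVneq y z.
    by exists [::]; [split=> //=; rewrite yz | move=> u /Hy; exists y => //; rewrite inE].
  exists [:: z]; first by split; rewrite //= andbT lt_neqAle yz (le_trans yx).
  by move=> u /Hy; exists y => //; rewrite inE eqxx.
Qed.

(** A closed sequence of values goes from [f i] to [f j] and back. *)
Lemma closed_loop_variation_ge (R : realType) (f : nat -> R) (n i j : nat) :
  f 0%N = f n -> (i <= n)%N -> (j <= n)%N ->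
  2 * (f i - f j) <= \sum_(0 <= k < n) `|f k.+1 - f k|.
Proof.
move=> f0n.
have tel k l : (k <= l)%N -> `|f l - f k| <= \sum_(k <= i < l) `|f i.+1 - f i|.
  by move=> kl; rewrite -telescope_sumr //; exact: ler_norm_sum.
have key k l : (k <= l)%N -> (l <= n)%N ->
    2 * `|f l - f k| <= \sum_(0 <= k < n) `|f k.+1 - f k|.
  move=> kl ln; rewrite (big_cat_nat _ (n := k)) //=; last exact: leq_trans ln.
  rewrite (big_cat_nat kl ln) /=.
  have h1 := tel _ _ (leq0n k); have h2 := tel _ _ kl; have h3 := tel _ _ ln.
  have : `|f l - f k| <= `|f k - f 0%N| + `|f n - f l|.
    have -> : f l - f k = - (f k - f 0%N + (f n - f l)) by rewrite f0n; ring.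
    by rewrite normrN; exact: ler_normD.
  by lra.
move=> ni nj; have [ij|/ltnW ji] := leqP i j.
  apply: le_trans (key _ _ ij nj); rewrite ler_pM2l // distrC; exact: ler_norm.
by apply: le_trans (key _ _ ji ni); rewrite ler_pM2l // ler_norm.
Qed.

(** * Mean projection of a segment *)

Section AbsCosIntegral.
Variable R : realType.
Implicit Types a b t : R.
Local Notation mu := (@lebesgue_measure R).

(** Polar coordinates of [(- b, a)], which lies in the upper half-plane. *)
Lemma polar_upper_half a b : 0 <= a -> exists2 t0, 0 <= t0 <= pi &
  a = Num.sqrt (a ^+ 2 + b ^+ 2) * sin t0 /\
  b = - (Num.sqrt (a ^+ 2 + b ^+ 2) * cos t0).
Proof.
move=> a0; set r := Num.sqrt _.
have s0 : 0 <= a ^+ 2 + b ^+ 2 by rewrite addr_ge0 // sqr_ge0.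
have r2 : r ^+ 2 = a ^+ 2 + b ^+ 2 by rewrite sqr_sqrtr.
have r0 : 0 <= r by exact: sqrtr_ge0.
have [rz|rnz] := eqVneq r 0.
  exists 0; first by rewrite lexx pi_ge0.
  move: r2; rewrite rz expr0n /= => /esym/eqP.
  rewrite paddr_eq0 ?sqr_ge0 // !sqrf_eq0 => /andP[/eqP -> /eqP ->].
  by rewrite !mul0r oppr0.
have rp : 0 < r by rewrite lt_neqAle eq_sym rnz.
have br : -1 <= - b / r <= 1.
  have : `|b| <= r.
    by rewrite -ler_sqr ?nnegrE // ?r2 ?real_normK ?num_real // lerDr sqr_ge0.
  rewrite ler_norml => /andP[h1 h2].
  by rewrite ler_pdivlMr // ler_pdivrMr // mulN1r mul1r lerN2 h2 lerNl.
exists (acos (- b / r)); first by rewrite acos_ge0 // acos_lepi.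
rewrite sin_acos // acosK; last by rewrite in_itv.
split; last by rewrite mulrC divfK // opprK.
have -> : 1 - (- b / r) ^+ 2 = (a / r) ^+ 2.
  rewrite -(divff (x := r ^+ 2)) ?sqrf_eq0 // {1}r2.
  by field.
by rewrite sqrtr_sqr ger0_norm ?divr_ge0 // mulrC divfK.
Qed.

Lemma is_derive_rcos (r t0 t : R) :
  is_derive t 1 (fun s => r * cos (t0 - s)) (r * sin (t0 - t)).
Proof.
have h : is_derive t 1 (fun s => t0 - s) (-1).
  have -> : (fun s => t0 - s) = (cst t0 - id) :> (R -> R) by apply/funext.
  by rewrite -[-1]sub0r; apply: is_deriveB.
have hc : is_derive t 1 (fun s => cos (t0 - s)) (sin (t0 - t)).
  have := @is_derive1_comp R cos (fun s => t0 - s) t (- sin (t0 - t)) (-1)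
    (is_derive_cos _) h.
  by rewrite /GRing.scale /= mulrNN mulr1.
exact: (@is_deriveZ R R^o R^o _ r t 1 _ hc).
Qed.

Lemma integral_abs_dir_half (r t0 : R) : 0 <= r -> 0 <= t0 <= pi ->
  (\int[mu]_(t in `[0%R, pi]) `|r * sin (t0 - t)|%:E = (2 * r)%:E)%E.
Proof.
move=> r0 /andP[t00 t0pi].
have msin : measurable_fun setT (fun t => r * sin (t0 - t)).
  apply: continuous_measurable_fun => t.
  apply: continuousM; first exact: cst_continuous.
  apply: continuous_comp; last exact: continuous_sin.
  by apply: continuousB; [exact: cst_continuous | exact: cvg_id].
have E1 : (\int[mu]_(t in `[0%R, t0]) `|r * sin (t0 - t)|%:E = (r - r * cos t0)%:E)%E.
  transitivity (\int[mu]_(t in `[0%R, t0]) (derive1 (fun s => r * cos (t0 - s)) t)%:E)%E.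
    apply: eq_integral => t; rewrite inE /= in_itv /= => /andP[h1 h2].
    rewrite derive1E (@derive_val _ _ _ _ _ _ _ (is_derive_rcos r t0 t)) ger0_norm //.
    by rewrite mulr_ge0 // sin_ge0_pi // subr_ge0 h2 /=; lra.
  rewrite ge0_derivable_FTC2 //.
  - by rewrite subrr subr0 cos0 mulr1.
  - move=> t /andP[h1 h2].
    rewrite derive1E (@derive_val _ _ _ _ _ _ _ (is_derive_rcos r t0 t)).
    by rewrite mulr_ge0 // sin_ge0_pi // subr_ge0 h2 /=; lra.
have E2 : (\int[mu]_(t in `[t0, pi]) `|r * sin (t0 - t)|%:E = (r + r * cos t0)%:E)%E.
  transitivity (\int[mu]_(t in `[t0, pi])
      (derive1 (fun s => (- r) * cos (t0 - s)) t)%:E)%E.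
    apply: eq_integral => t; rewrite inE /= in_itv /= => /andP[h1 h2].
    rewrite derive1E (@derive_val _ _ _ _ _ _ _ (is_derive_rcos (-r) t0 t)).
    rewrite mulNr ler0_norm // -oppr_ge0 -mulrN -sinN opprB mulr_ge0 // sin_ge0_pi //.
    by rewrite subr_ge0 h1 /=; lra.
  rewrite ge0_derivable_FTC2 //.
  - rewrite subrr cos0 mulr1 -[t0 - pi]opprB cosN -[pi - t0]addrC cosDpi cosN.
    by congr EFin; ring.
  - move=> t /andP[h1 h2].
    rewrite derive1E (@derive_val _ _ _ _ _ _ _ (is_derive_rcos _ t0 t)).
    rewrite mulNr -mulrN -sinN opprB mulr_ge0 // sin_ge0_pi //.
    by rewrite subr_ge0 h1 /=; lra.
have -> : `[0%R, pi]%classic = `[0%R, t0] `|` `]t0, pi] :> set R.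
  by rewrite -itv_bndbnd_setU // bnd_simp.
rewrite ge0_integral_setU //=.
- rewrite integral_itv_obnd_cbnd; last first.
    apply/measurable_EFinP/measurableT_comp => //.
    exact: measurable_funTS.
  by rewrite E1 E2 -EFinD; congr EFin; ring.
- apply/measurable_EFinP/measurableT_comp => //.
  exact: measurable_funTS.
- apply/disj_setPS => t [] /=; rewrite !in_itv /= => /andP[_ h] /andP[h' _].
  by have := lt_le_trans h' h; rewrite ltxx.
Qed.

(** Cauchy's formula for the length of the segment with coordinates [(a, b)]. *)
Lemma integral_abs_dir a b :
  (\int[mu]_(t in `[0%R, pi]) `|a * cos t + b * sin t|%:E =
   (2 * Num.sqrt (a ^+ 2 + b ^+ 2))%:E)%E.
Proof.
wlog a0 : a b / 0 <= a => [H|].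
  have [a0|a0] := leP 0 a; first exact: H.
  rewrite -(sqrrN a) -(sqrrN b) -H ?oppr_ge0 ?(ltW a0) //.
  by apply: eq_integral => t _; rewrite !mulNr -opprD normrN.
(* With these polar coordinates, a cos t + b sin t = r sin (t0 - t). *)
have [t0 t0pi [aE bE]] := polar_upper_half b a0.
rewrite -(integral_abs_dir_half (sqrtr_ge0 _) t0pi).
apply: eq_integral => t _; congr (`| _ |%:E).
move: aE bE; move: (Num.sqrt _) => r -> ->; rewrite sinB; ring.
Qed.

End AbsCosIntegral.

(** * Convex regions of the plane *)

Section ConvexInterior.
Variables (R : realType) (V : normedModType R) (K : set V).
Hypothesis cK : convex_set (K : set (convex_lmodType V)).

Lemma convex_set_comb (x y : V) (l : R) : K x -> K y -> 0 <= l -> l <= 1 ->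
  K (l *: x + (1 - l) *: y).
Proof.
move=> Kx Ky l0 l1; apply: set_mem.
exact: (@cK x y (Itv01 l0 l1) (mem_set Kx) (mem_set Ky)).
Qed.

(** A segment from an interior point to a point of a convex set is interior,
    except perhaps for its second end. *)
Lemma interior_convex_segment (x y : V) (l : R) : K° x -> K y -> 0 <= l -> l < 1 ->
  K° (x + l *: (y - x)).
Proof.
move=> Kx Ky l0 l1; have l10 : 1 - l != 0 by rewrite subr_eq0 gt_eqF.
(* The homothety of center y that sends the given point to x. *)
pose g (q : V) := (1 - l)^-1 *: (q - l *: y).
have gz : g (x + l *: (y - x)) = x.
  have -> : g (x + l *: (y - x)) = (1 - l)^-1 *: ((1 - l) *: x).
    congr (_ *: _); rewrite scalerBr scalerBl scale1r -addrA; congr (_ + _).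
    by rewrite addrAC subrr add0r.
  by rewrite scalerA mulVf // scale1r.
have cg : {for x + l *: (y - x), continuous g}.
  apply: (@continuousZr R V V).
  by apply: continuousB; [exact: cvg_id | exact: cst_continuous].
rewrite /interior; have : nbhs (g (x + l *: (y - x))) K by rewrite gz.
move=> /cg; rewrite nbhs_simpl /=; apply: filterS => q /= Kgq.
have := convex_set_comb Ky Kgq l0 (ltW l1).
by rewrite /g scalerA mulfV // scale1r addrC subrK.
Qed.

(** On a line through an interior point, two frontier points lie on opposite sides
    of that point: otherwise the nearer one would be interior. *)
Lemma frontier_opposite_sides (x v : V) (s t : R) : K° x ->
  (K `\` K°) (x + s *: v) -> (K `\` K°) (x + t *: v) -> s != t -> s * t < 0.
Proof.
move=> Kx.
have key (s' t' : R) : (K `\` K°) (x + s' *: v) -> (K `\` K°) (x + t' *: v) ->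
    `|s'| <= `|t'| -> s' != t' -> s' * t' < 0.
  move=> [_ nKs] [Kt nKt] st' nst; rewrite ltNge; apply/negP => st0.
  have t0 : t' != 0 by apply/eqP => t0; apply: nKt; rewrite t0 scale0r addr0.
  have l0 : 0 <= s' / t'.
    have -> : s' / t' = s' * t' * (t'^-1 ^+ 2) by field.
    by rewrite mulr_ge0 // sqr_ge0.
  have l1 : s' / t' < 1.
    rewrite lt_neqAle; apply/andP; split.
      by apply: contra nst => /eqP h; rewrite -[s'](divfK t0) h mul1r.
    rewrite -[s' / t']ger0_norm // normrM normfV ler_pdivrMr ?normr_gt0 //.
    by rewrite mul1r.
  apply: nKs; have := interior_convex_segment Kx Kt l0 l1.
  by rewrite addrAC subrr add0r scalerA divfK.
move=> Ks Kt st; have [h|/ltW h] := leP `|s| `|t|; first exact: key.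
by rewrite mulrC; apply: key => //; rewrite eq_sym.
Qed.

End ConvexInterior.

Section SupportOfRegion.
Variables (R : realType) (K : set (plane R)).
Hypothesis compactK : compact K.
Hypothesis cK : convex_set (K : set (convex_lmodType (plane R))).
Hypothesis K0 : K° (0, 0).
Implicit Types (q r u : plane R) (t : R).

Lemma dot_continuous u : continuous (fun q => dot q u).
Proof.
move=> q; rewrite /dot; apply: (@cvgD R R^o); apply: cvgM.
- exact: cvg_fst.
- exact: cvg_cst.
- exact: cvg_snd.
- exact: cvg_cst.
Qed.

Lemma dot_dir_dir t : dot (@dir R t) (dir t) = 1.
Proof. by rewrite /dot /dir /= -!expr2 cos2Dsin2. Qed.

Lemma interior_not_maximal r t : K° r -> exists2 q, K q & dot r (dir t) < dot q (dir t).
Proof.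
move=> Kr.
pose g (s : R) : plane R := r + s *: (dir t : plane R).
have g0 : g 0 = r by rewrite /g scale0r addr0.
have cg : {for 0, continuous g}.
  apply: continuousD; first exact: cst_continuous.
  exact: scalel_continuous.
have : nbhs (g 0) K by rewrite g0.
move=> /cg; rewrite nbhs_simpl /= => /nbhs_ballP[e /= e0 H].
exists (g (e / 2)).
  apply: H; rewrite /ball /= sub0r normrN gtr0_norm ?divr_gt0 //; lra.
rewrite /g /dot /=.
have := dot_dir_dir t; rewrite /dot /dir /= => h.
have : 0 < e / 2 * (cos t * cos t + sin t * sin t) by rewrite h mulr1 divr_gt0.
by rewrite /GRing.scale /=; lra.
Qed.

(** The maximum over the region is attained on the frontier. It is nonnegative
    since the origin belongs to the region. *)
Lemma support_point t : exists r, [/\ (K `\` K°) r, 0 <= dot r (dir t) &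
  forall q, K q -> dot q (dir t) <= dot r (dir t)].
Proof.
have K00 : K (0, 0) := interior_subset K0.
have [||r /set_mem Kr rmax] := @compact_EVT_max _ R (fun q => dot q (dir t)) K _ compactK.
- by exists (0, 0).
- exact/continuous_subspaceT/dot_continuous.
have {}rmax q : K q -> dot q (dir t) <= dot r (dir t) by move=> /mem_set; exact: rmax.
exists r; split => //.
- split=> // /(interior_not_maximal t)[q Kq]; rewrite ltNge => /negP; apply.
  exact: rmax.
- by apply: le_trans (rmax _ K00); rewrite /dot /= !mul0r addr0.
Qed.

(** The distance from the origin to the tangent line with outward normal [dir t]
    is the maximum of the projections on [dir t]. *)
Lemma support_functionE (gam : R -> plane R) t r :
  trace gam = K `\` K° -> (K `\` K°) r -> 0 <= dot r (dir t) ->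
  (forall q, K q -> dot q (dir t) <= dot r (dir t)) ->
  support_function (trace gam) t = dot r (dir t).
Proof.
move=> -> Gr r0 rmax; set h := dot r (dir t) in r0 rmax *.
have TE : tangent_line (K `\` K°) t = [set q | dot q (dir t) = h].
  apply/seteqP; split => q /=.
    move=> [r' [Kr' _] [-> r'max]]; apply/le_anti.
    by rewrite rmax // r'max.
  by move=> qh; exists r => //; split=> // s [Ks _]; exact: rmax.
rewrite /support_function /dist_to_set TE.
have distE q : euclidean_dist (0, 0) q = Num.sqrt (q.1 ^+ 2 + q.2 ^+ 2).
  by rewrite /euclidean_dist /= !sub0r !sqrrN.
have cs2 := cos2Dsin2 t.
have hin : [set euclidean_dist (0, 0) q | q in [set q | dot q (dir t) = h]] h.
  exists (h *: (dir t : plane R)).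
    by rewrite /dot /dir /= /GRing.scale /= -!mulrA -mulrDr -!expr2 cs2 mulr1.
  rewrite distE /= /GRing.scale /= !exprMn -mulrDr cs2 mulr1.
  by rewrite sqrtr_sqr ger0_norm.
have hlb : lbound [set euclidean_dist (0, 0) q | q in [set q | dot q (dir t) = h]] h.
  move=> _ [q /= qh <-]; rewrite distE -[leLHS]ger0_norm // -sqrtr_sqr ler_wsqrtr //.
  rewrite -qh /dot /dir /=; set c := cos t; set s := sin t.
  have -> : q.1 ^+ 2 + q.2 ^+ 2 =
     (q.1 * c + q.2 * s) ^+ 2 + (q.1 * s - q.2 * c) ^+ 2.
    rewrite -[LHS]mulr1 -cs2 -/c -/s; ring.
  by rewrite lerDl sqr_ge0.
apply/le_anti/andP; split.
  by apply: ge_inf => //; exists h.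
by apply: lb_le_inf => //; exists h.
Qed.

(** Points with the same projection on [dir t] differ by a multiple of the unit
    vector orthogonal to [dir t]. *)
Lemma orthogonal_decomposition q r t : dot q (dir t) = dot r (dir t) ->
  exists s, q = r + s *: ((- sin t, cos t) : plane R).
Proof.
case: q r => [q1 q2] [r1 r2]; rewrite /dot /dir /= => E.
have cs2 := cos2Dsin2 t.
exists ((q2 - r2) * cos t - (q1 - r1) * sin t).
move: E cs2; set c := cos t; set s := sin t => E cs2.
have E1 : (q1 - r1) * c = - ((q2 - r2) * s) by lra.
have E2 : (q2 - r2) * s = - ((q1 - r1) * c) by lra.
congr pair; apply/esym/eqP; rewrite /= -subr_eq0; apply/eqP.
  transitivity (- ((q1 - r1) * c * c + (q2 - r2) * s * c)
                + (q1 - r1) * (c ^+ 2 + s ^+ 2 - 1)).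
    by rewrite /GRing.scale /=; ring.
  by rewrite E1 cs2; ring.
transitivity (- ((q2 - r2) * s * s + (q1 - r1) * c * s)
              + (q2 - r2) * (c ^+ 2 + s ^+ 2 - 1)).
  by rewrite /GRing.scale /=; ring.
by rewrite E2 cs2; ring.
Qed.

(** A line through an interior point meets the frontier in at most two points:
    of three distinct points, two would lie on the same side. *)
Lemma frontier_line_le2 t m q1 q2 q3 : K° m ->
  (K `\` K°) q1 -> (K `\` K°) q2 -> (K `\` K°) q3 ->
  dot q1 (dir t) = dot m (dir t) -> dot q2 (dir t) = dot m (dir t) ->
  dot q3 (dir t) = dot m (dir t) -> [\/ q1 = q2, q2 = q3 | q3 = q1].
Proof.
move=> Km K1 K2 K3 /orthogonal_decomposition[s1 E1].
move=> /orthogonal_decomposition[s2 E2] /orthogonal_decomposition[s3 E3].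
rewrite {}E1 {}E2 {}E3 in K1 K2 K3 *.
have [->|n12] := eqVneq s1 s2; first by constructor 1.
have [->|n23] := eqVneq s2 s3; first by constructor 2.
have [->|n31] := eqVneq s3 s1; first by constructor 3.
have h12 := frontier_opposite_sides cK Km K1 K2 n12.
have h23 := frontier_opposite_sides cK Km K2 K3 n23.
have h31 := frontier_opposite_sides cK Km K3 K1 n31.
have : 0 <= (s1 * s2) * (s2 * s3) * (s3 * s1).
  have -> : (s1 * s2) * (s2 * s3) * (s3 * s1) = (s1 * s2 * s3) ^+ 2 by ring.
  exact: sqr_ge0.
by rewrite leNgt => /negP[]; rewrite pmulr_rlt0 // nmulr_rgt0.
Qed.

(** Every intermediate level of a projection is attained at an interior point,
    on the segment from the origin to [A] or to [B]. *)
Lemma interior_level t c A B : K A -> K B ->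
  dot A (dir t) < c -> c < dot B (dir t) ->
  exists2 m, K° m & dot m (dir t) = c.
Proof.
move=> KA KB Ac cB.
have key C : K C -> `|c| < `|dot C (dir t)| -> 0 <= c * dot C (dir t) ->
    exists2 m, K° m & dot m (dir t) = c.
  move=> KC; set d := dot C (dir t) => cd cd0.
  have d0 : d != 0 by rewrite -normr_gt0 (le_lt_trans _ cd).
  exists ((0, 0) + (c / d) *: (C - (0, 0))).
    apply: interior_convex_segment => //.
      have -> : c / d = c * d * (d^-1 ^+ 2) by field.
      by rewrite mulr_ge0 // sqr_ge0.
    have [cd1|cd1] := leP 0 (c / d); last by apply: lt_trans cd1 _.
    rewrite -[ltLHS]ger0_norm // normrM normfV ltr_pdivrMr ?normr_gt0 //.
    by rewrite mul1r.
  rewrite /dot /= /GRing.scale /= !subr0 !add0r -!mulrA -!mulrDr.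
  by rewrite -[_ + _]/(dot C (dir t)) -/d mulVf // mulr1.
have [c0|c0] := leP 0 c.
  have B0 := le_lt_trans c0 cB.
  by apply: (key B) => //; rewrite ?mulr_ge0 ?(ltW B0) // !ger0_norm // ltW.
have A0 := lt_trans Ac c0.
apply: (key A) => //; first by rewrite !ltr0_norm // ltrN2.
by rewrite mulr_le0 // ltW.
Qed.

End SupportOfRegion.

(** * The perimeter of an oval as the integral of its width *)

Section Perimeter.
Variables (R : realType) (gam : R -> plane R) (K : set (plane R)).
Hypothesis gam_closed : simple_closed_curve gam.
Hypothesis compactK : compact K.
Hypothesis cK : convex_set (K : set (convex_lmodType (plane R))).
Hypothesis K0 : K° (0, 0).
Hypothesis traceE : trace gam = K `\` K°.
Local Notation mu := (@lebesgue_measure R).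
Local Notation p := (support_function (trace gam)).
Implicit Types (t u : R) (s : seq R).

Lemma dirDpi t : @dir R (t + pi) = - dir t.
Proof. by rewrite /dir sinDpi cosDpi. Qed.

Lemma dot_dirDpi (q : plane R) t : dot q (dir (t + pi)) = - dot q (dir t).
Proof. by rewrite dirDpi /dot /= !mulrN opprD. Qed.

Lemma support_functionP t : exists r, [/\ (K `\` K°) r, p t = dot r (dir t) &
  forall q, K q -> dot q (dir t) <= p t].
Proof.
have [r [Kr r0 rmax]] := support_point compactK K0 t.
by exists r; rewrite (support_functionE traceE Kr r0 rmax).
Qed.

Lemma support_function_ge0 t : 0 <= p t.
Proof.
have [r [_ _ /(_ (0, 0))]] := support_functionP t.
rewrite /dot /= !mul0r addr0; apply; exact: (interior_subset K0).
Qed.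

(** The least projection on [dir t] is [- p (t + pi)]. *)
Lemma support_function_opp t : exists r, [/\ (K `\` K°) r,
  - p (t + pi) = dot r (dir t) & forall q, K q -> - p (t + pi) <= dot q (dir t)].
Proof.
have [r [Kr pr rmax]] := support_functionP (t + pi).
exists r; split => //; first by rewrite pr dot_dirDpi opprK.
by move=> q /rmax; rewrite dot_dirDpi lerNl.
Qed.

Lemma gam_frontier u : 0 <= u <= 1 -> (K `\` K°) (gam u).
Proof. by move=> u01; rewrite -traceE; exists u => //; rewrite /= in_itv. Qed.

Lemma frontier_gam q : (K `\` K°) q -> exists2 u, 0 <= u <= 1 & gam u = q.
Proof. by rewrite -traceE => -[u /=]; rewrite in_itv /= => u01 <-; exists u. Qed.

Lemma dot_dir_measurable (q : plane R) :
  measurable_fun setT (fun t => dot q (dir t)).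
Proof.
apply: continuous_measurable_fun => t; rewrite /dot.
apply: (@cvgD R R^o); apply: cvgM.
- exact: cvg_cst.
- exact: continuous_cos.
- exact: cvg_cst.
- exact: continuous_sin.
Qed.

Section Partition.
Variable s : seq R.
Hypothesis s_part : itv_partition 0 1 s.
Local Notation x i := ((0 :: s)`_i).

Lemma partition_incr i : (i < size s)%N -> x i < x i.+1.
Proof. by case: s_part => /(pathP 0) + _; exact. Qed.

Lemma partition_last : x (size s) = 1.
Proof. by case: s_part => _ /eqP <-; rewrite (last_nth 0). Qed.

Lemma partition_itv i : (i <= size s)%N -> 0 <= x i <= 1.
Proof.
move=> ins; apply/andP; split.
  exact: (incr_le partition_incr (leq0n i) ins).
rewrite -[X in _ <= X]partition_last.
exact: (incr_le partition_incr ins (leqnn _)).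
Qed.

(** The total length of the projections on the direction [dir t] of the edges of
    the polygon inscribed in [gam] at the points of the partition [0 :: s]. *)
Definition projected_length t :=
  \sum_(0 <= i < size s) `|dot (gam (x i.+1)) (dir t) - dot (gam (x i)) (dir t)|.

Lemma projected_length_le t : projected_length t <= 2 * width p t.
Proof.
have [cg g01 ginj] := gam_closed.
have [A [KA Am Amin]] := support_function_opp t.
have [B [KB BM Bmax]] := support_functionP t.
have -> : width p t = p t - - p (t + pi) by rewrite opprK.
pose phi u := dot (gam u) (dir t).
apply: (@variation_le_of_le2_preimages _ 0 1 phi).
- apply/subspace_continuousP => u ui.
  have /subspace_continuousP/(_ u ui) cgu := cg.
  exact: (cvg_comp gam (fun q => dot q (dir t)) cgu (@dot_continuous _ _ _)).
- by rewrite BM; apply: Amin; case: KB.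
- by move=> u /gam_frontier[Ku _]; rewrite Amin // Bmax.
- move=> c u1 u2 u3 /andP[mc cM] h1 h2 h3 e1 e2 e3.
  have [m Km mE] : exists2 m, K° m & dot m (dir t) = c.
    by apply: (interior_level cK K0 (proj1 KA) (proj1 KB)); rewrite -?Am -?BM.
  have fr u : 0 < u < 1 -> (K `\` K°) (gam u).
    by move=> /andP[u0 u1']; apply: gam_frontier; rewrite !ltW.
  have co u : 0 < u < 1 -> u \in `[0, 1[.
    by move=> /andP[u0 u1']; rewrite in_itv /= u1' ltW.
  rewrite -mE in e1 e2 e3.
  case: (frontier_line_le2 cK Km (fr _ h1) (fr _ h2) (fr _ h3) e1 e2 e3) => /ginj h.
  + by constructor 1; apply: h; exact: co.
  + by constructor 2; apply: h; exact: co.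
  + by constructor 3; apply: h; exact: co.
- exact: partition_itv.
- exact: partition_incr.
Qed.

(** The norm of the plane is the maximum of the two coordinates in absolute value,
    hence the factor 2. *)
Lemma dot_dirB_le (q r : plane R) t :
  `|dot q (dir t) - dot r (dir t)| <= 2 * `|q - r|.
Proof.
have -> : dot q (dir t) - dot r (dir t) =
    (q - r).1 * cos t + (q - r).2 * sin t by rewrite /dot /=; ring.
have h1 : `|(q - r).1| <= `|q - r| by rewrite prod_normE le_max lexx.
have h2 : `|(q - r).2| <= `|q - r| by rewrite prod_normE le_max lexx orbT.
have c1 : `|cos t| <= 1 by rewrite ler_norml cos_geN1 cos_le1.
have s1 : `|sin t| <= 1 by rewrite ler_norml sin_geN1 sin_le1.
rewrite [leRHS]mulr_natl mulr2n; apply: le_trans (ler_normD _ _) _; rewrite !normrM.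
by apply: lerD; [rewrite -[leRHS]mulr1 ler_pM | rewrite -[leRHS]mulr1 ler_pM].
Qed.

Lemma projected_length_ge e t :
  (forall u, 0 <= u <= 1 -> exists2 y, y \in 0 :: s & `|gam u - gam y| <= e) ->
  2 * (width p t - 4 * e) <= projected_length t.
Proof.
move=> fine; have [cg g01 ginj] := gam_closed.
have approx q : (K `\` K°) q -> exists2 i, (i <= size s)%N &
    `|dot q (dir t) - dot (gam (x i)) (dir t)| <= 2 * e.
  move=> /frontier_gam[u /fine [y ys yu] <-].
  exists (index y (0 :: s)); first by move: ys; rewrite -index_mem.
  rewrite nth_index //; apply: le_trans (dot_dirB_le _ _ _) _.
  by rewrite ler_pM2l.
have [A [/approx[j jz jA] Am _]] := support_function_opp t.
have [B [/approx[i iz iB] BM _]] := support_functionP t.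
have := @closed_loop_variation_ge R (fun i => dot (gam (x i)) (dir t)) _ i j _ iz jz.
rewrite -/(projected_length t) /= partition_last -g01 => /(_ erefl).
apply: le_trans; rewrite ler_pM2l // /width.
move: iB jA; rewrite -Am -BM !ler_norml => /andP[_ h1] /andP[h2 _]; lra.
Qed.

Lemma integral_projected_length :
  (\int[mu]_(t in `[0%R, pi]) (projected_length t)%:E =
   (2 * polygon_length gam (0%R :: s))%:E)%E.
Proof.
under eq_integral do rewrite /projected_length -sumEFin.
rewrite ge0_integral_sum //=; last first.
  move=> i; apply/measurable_EFinP/measurableT_comp => //.
  by apply: measurable_funB; apply: measurable_funTS; exact: dot_dir_measurable.
rewrite /polygon_length /= mulr_sumr -sumEFin; apply: eq_bigr => i _.
rewrite /euclidean_dist -integral_abs_dir; apply: eq_integral => t _.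
by rewrite distrC; congr (`| _ |%:E); rewrite /dot /=; ring.
Qed.

Lemma projected_length_measurable : measurable_fun setT projected_length.
Proof.
apply: measurable_sum => i; apply: measurableT_comp => //.
by apply: measurable_funB; exact: dot_dir_measurable.
Qed.

End Partition.

Lemma perimeterE : mu.-integrable `[0%R, pi] (EFin \o width p) ->
  perimeter gam = (\int[mu]_(t in `[0, pi]) width p t)%:E.
Proof.
move=> iw.
have w0 t : 0 <= width p t by rewrite addr_ge0 // support_function_ge0.
have mw : measurable_fun `[0%R, pi] (EFin \o width p) by exact: measurable_int iw.
have mpl s : measurable_fun `[0%R, pi] (projected_length s).
  by apply: measurable_funTS; exact: projected_length_measurable.
have pl0 s t : 0 <= projected_length s t by apply: sumr_ge0.
set W : R := \int[mu]_(t in _) _.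
have WE : (\int[mu]_(t in `[0%R, pi]) (width p t)%:E = W%:E)%E.
  by rewrite /W /Rintegral fineK //; exact: integrable_fin_num.
have W2 : (\int[mu]_(t in `[0%R, pi]) (2 * width p t)%:E = (2 * W)%:E)%E.
  under eq_integral do rewrite EFinM.
  rewrite ge0_integralZl_EFin //; first by rewrite WE.
  by move=> t _; rewrite lee_fin.
have mw2 : measurable_fun `[0%R, pi] (fun t => (2 * width p t)%:E).
  by apply/measurable_EFinP/measurable_funM => //; exact/measurable_EFinP.
apply/eqP; rewrite eq_le; apply/andP; split.
  apply: ge_ereal_sup => _ [s sp <-]; rewrite lee_fin.
  rewrite -(ler_pM2l (x := 2)) // -lee_fin -W2 -integral_projected_length.
  apply: ge0_le_integral => //=.
  - by move=> t _; rewrite lee_fin.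
  - by apply/measurable_EFinP; exact: mpl.
  - by move=> t _; rewrite lee_fin; exact: projected_length_le.
have [cg g01 ginj] := gam_closed.
apply/lee_addgt0Pr => e e0.
(* The error 4 (e / (4 pi)) on the width integrates over [0, pi] to e. *)
have e40 : 0 < e / (4 * pi) by rewrite divr_gt0 // mulr_gt0 // pi_gt0.
have [s sp fine] := exists_fine_partition ler01 cg e40.
apply: (@le_trans _ _ ((polygon_length gam (0 :: s))%:E + e%:E)%E); last first.
  by apply: leeD => //; apply: ereal_sup_ubound; exists s.
rewrite -EFinD lee_fin -(ler_pM2l (x := 2)) // mulrDr -lee_fin EFinD.
rewrite -W2 -integral_projected_length.
have -> : (2 * e)%:E = (\int[mu]_(t in `[0%R, pi]) cst (8 * (e / (4 * pi)))%:E t)%E.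
  rewrite integral_cst //= lebesgue_measure_itv /= lte_fin pi_gt0 -EFinB -EFinM.
  congr EFin; move: (@pi R) (pi_gt0 R) => c c0; field; exact: lt0r_neq0.
have e80 : 0 <= 8 * (e / (4 * pi)) by rewrite mulr_ge0 // ltW.
rewrite -ge0_integralD //=; first last.
- by apply/measurable_EFinP; exact: mpl.
- by move=> t _; rewrite lee_fin.
apply: ge0_le_integral => //=.
- by move=> t _; rewrite lee_fin mulr_ge0.
- by apply: emeasurable_funD => //; by apply/measurable_EFinP; exact: mpl.
- move=> t _; rewrite -EFinD lee_fin.
  have := projected_length_ge sp t fine; lra.
Qed.

End Perimeter.

(** * Averages of the width and of the radius of curvature *)

(** Second derivative test: at a minimum, a second derivative, if it exists, is
    nonnegative. *)
Lemma derive1_derive1_min_ge0 (R : realType) (d : R -> R) (t : R) :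
  (forall x, derivable d x 1) -> derivable (derive1 d) t 1 ->
  (forall x, d t <= d x) -> 0 <= derive1 (derive1 d) t.
Proof.
move=> dd ddt dmin.
have d't : derive1 d t = 0.
  rewrite derive1E; apply: derive_val.
  apply: (@derive1_at_min _ d (t - 1) (t + 1)) => //; first by lra.
  by rewrite in_itv /=; apply/andP; split; lra.
rewrite leNgt; apply/negP => neg.
(* Otherwise [derive1 d] is negative just after t, and d decreases there. *)
have c0 : 0 < - (derive1 (derive1 d) t) / 2 by rewrite divr_gt0 // oppr_gt0.
have [e e0 H] := derivable_approx c0 ddt.
have te : t < t + e / 2 by rewrite ltrDl divr_gt0.
have [||x] := @MVT R d (derive1 d) t (t + e / 2) te.
- by move=> y _; rewrite derive1E; exact: derivableP.
- by apply: derivable_within_continuous => y _; exact: dd.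
rewrite in_itv /= => /andP[tx xe] E.
have : derive1 d x * (t + e / 2 - t) < 0.
  rewrite nmulr_rlt0 ?subr_gt0 //.
  have := H x; rewrite gtr0_norm ?subr_gt0 // => /(_ ltac:(lra)).
  rewrite d't subr0 ler_norml => /andP[_ h].
  have : - derive1 (derive1 d) t * (x - t) > 0.
    by rewrite mulr_gt0 ?oppr_gt0 // subr_gt0.
  by lra.
by rewrite -E subr_lt0 ltNge dmin.
Qed.

Lemma Rintegral_shift (R : realType) (g : R -> R) (a b c : R) :
  continuous g -> a <= b ->
  \int[lebesgue_measure]_(x in `[a + c, b + c]) g x =
  \int[lebesgue_measure]_(x in `[a, b]) g (x + c).
Proof.
move=> cg ab.
have dF (x : R) : is_derive x 1 (fun y : R => y + c) (1 : R).
  rewrite -[X in is_derive _ _ _ X]addr0.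
  by apply: (@is_deriveD R R^o R^o id (cst c)).
have F1 : derive1 (fun y : R => y + c) = cst 1.
  by apply/funext => x; rewrite derive1E; exact: (@derive_val _ _ _ _ _ _ _ (dF x)).
have cF : continuous (fun y : R => y + c).
  move=> x; apply/differentiable_continuous/derivable1_diffP.
  exact: (@ex_derive _ _ _ _ _ _ _ (dF x)).
rewrite /Rintegral; congr fine.
rewrite (@integration_by_substitution_increasing _ (fun y => y + c)) //.
- apply: eq_integral => x _; rewrite /= F1.
  by rewrite -[(_ * _) x]/((g (x + c)) * 1) mulr1.
- by move=> x y _ _; rewrite ltrD2r.
- by rewrite F1 => x _; exact: cst_continuous.
- by rewrite F1; exact: is_cvg_cst.
- by rewrite F1; exact: is_cvg_cst.
- split.
  + by move=> x _; exact: (@ex_derive _ _ _ _ _ _ _ (dF x)).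
  + exact/cvg_at_right_filter/cF.
  + exact/cvg_at_left_filter/cF.
- exact: continuous_subspaceT.
Qed.

Lemma continuous_segment_integrable (R : realType) (g : R -> R) (a b : R) :
  continuous g -> lebesgue_measure.-integrable `[a, b] (EFin \o g).
Proof.
move=> cg; apply: continuous_compact_integrable; first exact: segment_compact.
exact: continuous_subspaceT.
Qed.

Lemma is_derive_cos_sin (R : realType) (a b s : R) :
  is_derive s 1 (fun t => a * cos t + b * sin t) (b * cos s - a * sin s).
Proof.
have da : is_derive s 1 (fun t => a * cos t) (a * - sin s).
  exact: (@is_deriveZ R R^o R^o cos a s 1 _ (is_derive_cos s)).
have db : is_derive s 1 (fun t => b * sin t) (b * cos s).
  exact: (@is_deriveZ R R^o R^o sin b s 1 _ (is_derive_sin s)).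
by rewrite addrC -mulrN; exact: (@is_deriveD R R^o R^o).
Qed.

Section SupportAverages.
Variables (R : realType) (p : R -> R).
Hypothesis p_twice : twice_differentiable p.
Local Notation mu := (@lebesgue_measure R).

Lemma twice_differentiable_continuous : continuous p.
Proof.
by move=> t; apply/differentiable_continuous/derivable1_diffP; case: (p_twice t).
Qed.

Lemma width_continuous : continuous (width p).
Proof.
have cp := twice_differentiable_continuous.
move=> t; apply: (@cvgD R R^o); first exact: cp.
apply: (cvg_comp (fun t => t + pi) p); last exact: cp.
by apply: (@cvgD R R^o); [exact: cvg_id | exact: cvg_cst].
Qed.

Lemma Rintegral_width :
  \int[mu]_(t in `[0, pi]) width p t = \int[mu]_(t in `[0, 2 * pi]) p t.
Proof.
have cp := twice_differentiable_continuous.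
have pi0 := pi_ge0 R.
rewrite /width RintegralD //=.
- rewrite -Rintegral_shift // add0r -mulr2n -[in LHS]mulr_natl.
  have := @Rintegral_itvB R p (BLeft 0) (BRight (2 * pi)) pi
    (continuous_segment_integrable _ _ cp).
  rewrite !bnd_simp => /(_ pi0) h.
  have {h}/h : pi <= 2 * pi :> R by lra.
  rewrite Rintegral_itv_obnd_cbnd; last first.
    apply: integrableS (continuous_segment_integrable pi (2 * pi) cp) => //.
    by apply: subset_itvr; rewrite bnd_simp.
  by move=> <-; rewrite addrC subrK.
- exact: continuous_segment_integrable.
- apply: (@continuous_segment_integrable R (fun t => p (t + pi))) => t.
  apply: (cvg_comp (fun t => t + pi) p); last exact: cp.
  by apply: (@cvgD R R^o); [exact: cvg_id | exact: cvg_cst].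
Qed.

Hypothesis p_periodic : forall t, p (t + 2 * pi) = p t.
Hypothesis rho0 : forall t, 0 <= curvature_radius p t.

Lemma derive1_periodic : derive1 p (2 * pi) = derive1 p 0.
Proof.
rewrite /derive1; congr (lim (_ @ 0^')).
by apply/funext => h; rewrite p_periodic -[2 * pi]add0r p_periodic addr0.
Qed.

(** When [p + p''] is nonnegative, [p''] is integrable over a period of [p], and its
    integral is 0. *)
Lemma Rintegral_curvature_radius :
  \int[mu]_(t in `[0, 2 * pi]) curvature_radius p t =
  \int[mu]_(t in `[0, 2 * pi]) p t.
Proof.
have cp := twice_differentiable_continuous.
have pi20 : 0 <= 2 * pi :> R by rewrite mulr_ge0 // pi_ge0.
have [c _ cmax] := EVT_max pi20 (@continuous_subspaceT _ _ `[0%R, 2 * pi]%classic _ cp).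
(* Adding C to p'' makes it nonnegative on [0, 2 pi], as p'' >= - p >= - C. *)
pose C := p c.
pose f t := derive1 p t + C * t.
have df (t : R) : is_derive t 1 f (derive1 (derive1 p) t + C).
  apply: is_deriveD.
    by rewrite derive1E; apply: derivableP; case: (p_twice t).
  rewrite -[X in is_derive _ _ _ X]mulr1.
  exact: (@is_deriveZ R R^o R^o id C t 1 1 (is_derive_id _ _)).
have f'E : derive1 f = (fun t => derive1 (derive1 p) t + C).
  by apply/funext => t; rewrite derive1E; exact: (@derive_val _ _ _ _ _ _ _ (df t)).
have dft (t : R) : derivable f t 1 by exact: (@ex_derive _ _ _ _ _ _ _ (df t)).
have f'0 t : 0 <= t <= 2 * pi -> 0 <= derive1 f t.
  move=> t2pi; rewrite f'E; apply: le_trans (rho0 t) _.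
  by rewrite /curvature_radius addrC lerD2l; apply: cmax; rewrite in_itv.
have FTC := ge0_derivable_FTC2 dft pi20 f'0.
have fE : f (2 * pi) - f 0 = 2 * pi * C.
  rewrite /f derive1_periodic; ring.
have if' : mu.-integrable `[0, 2 * pi] (EFin \o derive1 f).
  apply/integrableP; split.
    by apply/measurable_EFinP/measurable_funTS; exact: derive1_measurable.
  under eq_integral => t.
    rewrite inE /= in_itv /= => /f'0 h.
    by rewrite /= (ger0_norm h) over.
  by rewrite FTC ltry.
have cpC : continuous (fun t => p t - C).
  by move=> t; apply: (@cvgB R R^o); [exact: cp | exact: cvg_cst].
transitivity (\int[mu]_(t in `[0, 2 * pi]) (derive1 f t + (p t - C))).
  by apply: eq_Rintegral => t _; rewrite f'E /curvature_radius; ring.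
rewrite RintegralD //; last exact: continuous_segment_integrable.
rewrite RintegralB //; [|exact: continuous_segment_integrable | ].
  rewrite Rintegral_cst //= lebesgue_measure_itv /= lte_fin.
  rewrite mulr_gt0 ?pi_gt0 //=.
  rewrite [X in X + _]/Rintegral FTC fE /=; ring.
by apply: (@continuous_segment_integrable R (cst C)); exact: cst_continuous.
Qed.

End SupportAverages.

Theorem mainTheorem2 (R : realType) (gam : R -> plane R) (p : R -> R)
    (gam_oval : oval gam)
    (p_support : p = support_function (trace gam))
    (p_twice : twice_differentiable p) :
  perimeter gam = (pi * average_width p)%:E /\
  perimeter gam = (2 * pi * average_curvature_radius p)%:E.
Proof.
have [gam_closed [K [compactK cK K0 traceE]]] := gam_oval.
have per : perimeter gam = (\int[lebesgue_measure]_(t in `[0, pi]) width p t)%:E.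
  rewrite p_support; apply: (perimeterE gam_closed compactK cK K0 traceE).
  rewrite -p_support; apply: continuous_segment_integrable; exact: width_continuous.
have pi_neq0 : pi != 0 :> R by rewrite gt_eqF // pi_gt0.
split.
  by rewrite per /average_width mulrA divff // mul1r.
rewrite /average_curvature_radius mulrA divff ?mulf_neq0 // mul1r.
rewrite per Rintegral_width // Rintegral_curvature_radius // => t.
  rewrite p_support /support_function; congr dist_to_set.
  rewrite /tangent_line.
  have -> : dir (t + 2 * pi) = dir t by rewrite /dir mulr_natl cosD2pi sinD2pi.
  by [].
have [r [[Kr _] pr _]] := support_functionP compactK K0 traceE t.
(* p - g is minimal at t, where g is the projection of the support point r. *)
pose g s := r.1 * cos s + r.2 * sin s.
pose g' s := r.2 * cos s + - r.1 * sin s.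
have dg (s : R) : is_derive s 1 g (g' s).
  by rewrite /g' mulNr; exact: is_derive_cos_sin.
have dg' (s : R) : is_derive s 1 g' (- g s).
  by rewrite /g opprD -mulNr; exact: is_derive_cos_sin.
have dp (s : R) : is_derive s 1 p (derive1 p s).
  by rewrite derive1E; apply: derivableP; case: (p_twice s).
have ddp (s : R) : is_derive s 1 (derive1 p) (derive1 (derive1 p) s).
  by rewrite derive1E; apply: derivableP; case: (p_twice s).
have dd (s : R) : is_derive s 1 (p - g) (derive1 p s - g' s).
  exact: is_deriveB.
have d1E : derive1 (p - g) = derive1 p - g'.
  by apply/funext => s; rewrite derive1E; exact: (@derive_val _ _ _ _ _ _ _ (dd s)).
have ddd (s : R) : is_derive s 1 (derive1 (p - g)) (derive1 (derive1 p) s + g s).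
  by rewrite d1E -[g s]opprK; exact: is_deriveB.
have gt : g t = p t by rewrite p_support pr.
have := @derive1_derive1_min_ge0 R (p - g) t.
rewrite [in X in _ -> _ -> _ -> X]derive1E (@derive_val _ _ _ _ _ _ _ (ddd t)).
rewrite /curvature_radius -gt [g t + _]addrC; apply.
- by move=> s; exact: (@ex_derive _ _ _ _ _ _ _ (dd s)).
- exact: (@ex_derive _ _ _ _ _ _ _ (ddd t)).
- move=> s; rewrite -[leLHS]/(p t - g t) -[leRHS]/(p s - g s) gt subrr subr_ge0.
  rewrite p_support.
  by have [r' [_ _ r'max]] := support_functionP compactK K0 traceE s; exact: r'max.
Qed.
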